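(* Let $\Lambda$ be the shape function. Then $\Lambda(0)=c$, $\Lambda(1)=\Lambda(-1)=0$, and $\Lambda(\alpha)>c(1-|\alpha|)$ for all $0<|\alpha|<1$. Moreover, there is a constant $K>0$ such that $\Lambda(\alpha)\le c-K|\alpha|$ for all $\alpha\in[-1,1]$.
   Context: Let $c>0$, $q>0$, $\kappa>-1$. $F=(F(x))_{x\in\mathbb Z}$ and $B=(B(i))_{i\in\mathbb Z}$ are mutually independent families of i.i.d. random variables, $\mathbb P(B(i)=\pm1)=1/2$, and $F(x)$ has a density $\varrho$ that is even, continuous, strictly positive on $(-c,c)$, zero outside $(-c,c)$, with $\lim_{x\to c}\varrho(x)/|c-x|^{\kappa}=q$. Lazy walks $\gamma$ satisfy $|\gamma(i+1)-\gamma(i)|\le 1$; for a lazy walk $\gamma$ on $\{0,\dots,n\}$ the action is $A(B,F;\gamma)=\sum_{i=1}^n B(i)F(\gamma(i))$, and $\bar A(B,F;n,k)$ is the minimum of the action over lazy walks with $\gamma(0)=0$, $\gamma(n)=k$. $[x]$ denotes rounding towards $0$. The shape function is the deterministic continuous even concave function $\Lambda:[-1,1]\to[0,\infty)$ such that almost surely, for all $\alpha\in[-1,1]$, $\bar A(B,F;n,[\alpha n])/n\to-\Lambda(\alpha)$ as $n\to\infty$. *)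

(* Defs.v *)
From HB Require Import structures.
From mathcomp Require Import all_boot all_order all_algebra.
From mathcomp Require Import all_classical all_reals all_analysis.
Set Implicit Arguments. Unset Strict Implicit. Unset Printing Implicit Defensive.
Import Order.TTheory GRing.Theory Num.Theory.
Import numFieldNormedType.Exports.
Local Open Scope classical_set_scope.
Local Open Scope ring_scope.

Definition mutually_independent d (T : measurableType d) (R : realType)
  (P : probability T R) (I : eqType) (X : I -> {RV P >-> R}) : Prop :=
  forall (J : seq I) (A : I -> set R),
    uniq J -> (forall i, measurable (A i)) ->
    P (\bigcap_(i in [set` J]) (X i @^-1` A i)) =
      (\prod_(i <- J) P (X i @^-1` A i))%E.

Definition round_to_zero (R : realType) (x : R) : int :=
  if 0 <= x then Num.floor x else - Num.floor (- x).

Definition lazy_walk (n : nat) (g : nat -> int) : Prop :=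
  forall i : nat, (i < n)%N -> `|g i.+1 - g i| <= 1.

Definition action (R : realType) (b f : int -> R) (n : nat) (g : nat -> int) : R :=
  \sum_(1 <= i < n.+1) b (i%:Z) * f (g i).

(* bar A(B,F;n,k): minimum of the action over lazy walks g on {0..n}
   with g(0) = 0 and g(n) = k (a finite set of values; inf = min). *)
Definition min_action (R : realType) (b f : int -> R) (n : nat) (k : int) : R :=
  inf [set action b f n g | g in [set g | lazy_walk n g /\ g 0%N = 0 /\ g n = k]].

(* Main.v *)
(* Along every walk ending at k > 0 the sites 1, ..., k are all visited, so the
   action is at least - c n + sum_(x <= k) (c - |F x|), which gives
   Lambda a <= c - K |a|.  If F 0 is close to c and F 1 close to - c, hopping
   between these two sites according to the signs B gives Lambda 0 >= c.  The
   only walk reaching n at time n is the straight one and its action is centred,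
   so Lambda 1 = 0.

   By concavity the strict inequality is only needed at one point
   a = N / (N + 1).  There, cut the walk into blocks of duration N + 1 and length
   N, and in each block either wait one step at the beginning or one step at the
   end.  Both choices have centred actions, which differ by
   S_N = sum_(r <= N) B r (F r - F (r - 1)), so choosing the better one gains
   E|S_N| / 2 per block on average.  The moment bounds E S_N^2 >= v N and
   E S_N^4 = O(N^2) make E|S_N| unbounded, hence the gain exceeds c for N large.

   Since Lambda is deterministic, all averages are only needed in expectation,
   by dominated convergence; the only consequence of independence used for them
   is E[B i * Y] = 0 for Y measurable with respect to the other variables. *)
Require Import Defs.
From HB Require Import structures.
From mathcomp Require Import all_boot all_order all_algebra.
From mathcomp Require Import all_classical all_reals all_analysis.
From mathcomp Require Import measurable_realfun.
From mathcomp Require Import zify ring lra.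
Import Order.TTheory GRing.Theory Num.Theory.
Import numFieldNormedType.Exports.
Local Open Scope classical_set_scope.
Local Open Scope ring_scope.

(** * Deterministic estimates for the action of lazy walks *)

Section Walks.
Set Implicit Arguments.
Unset Strict Implicit.
Unset Printing Implicit Defensive.
Context {R : realType}.
Variables (c : R) (b f : int -> R).
Hypotheses (b_le1 : forall i, `|b i| <= 1) (f_lec : forall x, `|f x| <= c).

Lemma action_ge_norm n g :
  - \sum_(1 <= i < n.+1) `|f (g i)| <= action b f n g.
Proof.
rewrite /action -sumrN; apply: ler_sum => i _.
have : `|b i * f (g i)| <= `|f (g i)|.
  by rewrite normrM ler_piMl.
by rewrite ler_norml => /andP[].
Qed.

Lemma action_ge n g : - (c * n%:R) <= action b f n g.
Proof.
apply: le_trans (action_ge_norm n g); rewrite lerN2.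
have -> : c * n%:R = \sum_(1 <= i < n.+1) c.
  by rewrite sumr_const_nat subn1 mulr_natr.
by apply: ler_sum.
Qed.

Lemma min_action_le n k g : lazy_walk n g -> g 0%N = 0 -> g n = k ->
  min_action b f n k <= action b f n g.
Proof.
move=> lg g0 gn; apply: ge_inf; last by exists g.
by exists (- (c * n%:R)) => _ [h _ <-]; exact: action_ge.
Qed.

Lemma le_min_action (m : R) (n k : nat) : (k <= n)%N ->
  (forall g, lazy_walk n g -> g 0%N = 0 -> g n = k -> m <= action b f n g) ->
  m <= min_action b f n k.
Proof.
move=> kn H; apply: lb_le_inf.
  exists (action b f n (fun i => (minn i k)%:Z)), (fun i => (minn i k)%:Z) => //.
  split; [by move=> i ilt; lia|split; lia].
by move=> _ [g [lg [g0 gn]] <-]; exact: H.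
Qed.

(** Induction on time, all summands being nonnegative. If the walk is at or above [k] at time [n]
    already, the last term is dropped; otherwise the last step goes from [k - 1] to [k], its term
    pays for the site [k], and the induction hypothesis pays for the sites below. *)
Lemma visited_sites_le n g (k : nat) : lazy_walk n g -> g 0%N = 0 ->
  k%:Z <= g n ->
  \sum_(1 <= x < k.+1) (c - `|f x|) <= \sum_(1 <= i < n.+1) (c - `|f (g i)|).
Proof.
elim: n k => [|n IHn] k lg g0 kg.
  by have -> : k = 0%N by [lia]; rewrite !big_geq.
have lg' : lazy_walk n g by move=> i ilt; apply: lg; lia.
have step := lg n (ltnSn n).
rewrite [leRHS]big_nat_recr//=.
case: (lerP k%:Z (g n)) => kn.
  by apply: le_trans (IHn k lg' g0 kn) _; rewrite lerDl subr_ge0.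
have gk : g n.+1 = k by lia.
case: k kg kn gk => [|k] kg kn gk.
  rewrite big_geq// addr_ge0// ?subr_ge0//.
  by apply: sumr_ge0 => i _; rewrite subr_ge0.
by rewrite big_nat_recr//= gk lerD2r; apply: IHn => //; lia.
Qed.

Lemma action_ge_visited n g (k : nat) : lazy_walk n g -> g 0%N = 0 ->
  g n = k -> \sum_(1 <= x < k.+1) (c - `|f x|) - c * n%:R <= action b f n g.
Proof.
move=> lg g0 gn; apply: le_trans (action_ge_norm n g).
rewrite lerBlDr; apply: le_trans (visited_sites_le lg g0 _) _; first by rewrite gn.
by rewrite sumrB sumr_const_nat subn1 /= mulr_natr addrC.
Qed.

Lemma straight_walk n g : lazy_walk n g -> g 0%N = 0 -> g n = n ->
  forall i, (i <= n)%N -> g i = i.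
Proof.
move=> lg g0 gn i ilen.
have up j : (j <= n)%N -> g j <= j.
  elim: j => [|j IHj] jn; first by rewrite g0.
  by have := lg j jn; have := IHj (ltnW jn); lia.
(* Since each step is at most one, the endpoint [n] gives a lower bound when time is counted
   backwards. *)
have down j : (j <= n)%N -> (n - j)%N%:Z <= g (n - j)%N.
  elim: j => [|j IHj] jn; first by rewrite subn0 gn.
  have := lg (n - j.+1)%N ltac:(lia); have := IHj (ltnW jn).
  have -> : (n - j.+1).+1 = (n - j)%N by lia.
  lia.
have := down (n - i)%N (leq_subr _ _); rewrite subKn// => h1.
by have := up i ilen; lia.
Qed.

Lemma min_action_straight n :
  \sum_(1 <= i < n.+1) b i * f i <= min_action b f n n.
Proof.
apply: le_min_action => // g lg g0 gn; rewrite le_eqVlt; apply/orP; left; apply/eqP.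
rewrite /action !big_nat; apply: eq_bigr => i ilt.
by rewrite (straight_walk lg g0 gn)//; lia.
Qed.

Lemma min_action_two_sites (s : R) n : (forall i, b i = 1 \/ b i = -1) ->
  s <= f 0 -> f 1 <= - s -> min_action b f n.+1 0 <= c - s * n%:R.
Proof.
move=> bpm f0 f1.
(* Standing at [1] on positive signs and at [0] on negative ones costs at most [- s] at each of the
   times [1, ..., n]. Time [n + 1] is kept for the return to [0] and costs at most [c]. *)
pose g i : int := if (0 < i <= n)%N && (b i == 1) then 1 else 0.
have lg : lazy_walk n.+1 g.
  by move=> i _; rewrite /g; case: ifP => _; case: ifP => _; lia.
have gn : g n.+1 = 0 by rewrite /g ltnn andbF.
apply: le_trans (min_action_le lg _ gn) _ => //.
rewrite /action big_nat_recr//= gn addrC; apply: lerD.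
  apply: le_trans (ler_norm _) _; rewrite normrM.
  by apply: le_trans (f_lec 0); rewrite ler_piMl.
have -> : - (s * n%:R) = \sum_(1 <= i < n.+1) - s.
  by rewrite sumr_const_nat subn1 mulr_natr mulNrn.
rewrite !big_nat; apply: ler_sum => i /andP[i1 ilt].
rewrite /g i1 -ltnS ilt /=; case: eqP => [->|nb]; first by rewrite mul1r.
by have [//|->] := bpm i; rewrite mulN1r lerN2.
Qed.

Lemma append_walk n L g h : lazy_walk n g -> lazy_walk L h -> h 0%N = 0 ->
  exists g', [/\ lazy_walk (n + L) g', g' 0%N = g 0%N, g' (n + L)%N = g n + h L
    & action b f (n + L) g' =
      action b f n g + \sum_(r < L) b (n + r.+1)%N * f (g n + h r.+1)].
Proof.
move=> lg lh h0; pose g' i := if (i <= n)%N then g i else g n + h (i - n)%N.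
have g'E r : g' (n + r)%N = g n + h r.
  rewrite /g'; case: ifP => [nr|_]; last by rewrite addKn.
  by have -> : r = 0%N by [lia]; rewrite h0 addr0 addn0.
exists g'; split=> //.
- move=> i ilt; case: (ltnP i n) => [iltn|nlei].
    by rewrite /g' iltn ltnW//; exact: lg.
  have -> : i = (n + (i - n))%N by lia.
  rewrite -addnS !g'E; have := lh (i - n)%N; lia.
- rewrite /action (big_cat_nat (n := n.+1))//=; last by rewrite ltnS leq_addr.
  congr (_ + _).
    by rewrite !big_nat; apply: eq_bigr => i ilt; rewrite /g' -ltnS; case/andP: ilt => _ ->.
  rewrite -{1}(add0n n.+1) big_addn (_ : (n + L).+1 - n.+1 = L)%N; last lia.
  rewrite big_mkord; apply: eq_bigr => r _.
  by rewrite addnC addSnnS g'E.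
Qed.

(** Action over the times [t + 1, ..., t + N + 1] of a walk that is at [x] at time [t], waits there
    for one step and then advances to [x + N]. *)
Definition wait_first_block (N : nat) (t x : int) : R :=
  \sum_(r < N.+1) b (t + r.+1%:Z) * f (x + r%:Z).

Definition wait_last_block (N : nat) (t x : int) : R :=
  \sum_(r < N.+1) b (t + r.+1%:Z) * f (x + (minn r.+1 N)%:Z).

(** There is no term for time [t + N + 1], because both blocks are then at [x + N]. *)
Definition block_gap (N : nat) (t x : int) : R :=
  \sum_(r < N) b (t + r.+1%:Z) * (f (x + r.+1%:Z) - f (x + r%:Z)).

Lemma wait_blockB N t x :
  wait_last_block N t x - wait_first_block N t x = block_gap N t x.
Proof.
rewrite /wait_last_block /wait_first_block !big_ord_recr/= (minn_idPr (leqnSn N)).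
rewrite opprD addrACA subrr addr0 -sumrB.
by apply: eq_bigr => r _; rewrite -mulrBr (minn_idPl (ltn_ord r)).
Qed.

Lemma min_action_blocks N m :
  min_action b f (N.+1 * m) (N * m)%N <=
  \sum_(j < m) Num.min (wait_first_block N (N.+1 * j)%N (N * j)%N)
                       (wait_last_block N (N.+1 * j)%N (N * j)%N).
Proof.
suff [g [lg g0 gn <-]] : exists g, [/\ lazy_walk (N.+1 * m) g, g 0%N = 0,
    g (N.+1 * m)%N = (N * m)%N & action b f (N.+1 * m) g =
    \sum_(j < m) Num.min (wait_first_block N (N.+1 * j)%N (N * j)%N)
                         (wait_last_block N (N.+1 * j)%N (N * j)%N)].
  exact: min_action_le.
elim: m => [|m [g [lg g0 gn ag]]].
  exists (fun=> 0); rewrite !muln0; split=> //.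
  by rewrite /action big_geq// big_ord0.
(* Blocks are appended as walks started at [0]. The truncated predecessor sends both [0] and [1] to
   [0], which is the initial wait. *)
have lfirst : lazy_walk N.+1 (fun i => i.-1%:Z) by move=> i _; lia.
have llast : lazy_walk N.+1 (fun i => (minn i N)%:Z) by move=> i _; lia.
rewrite big_ord_recr/= -ag !mulnSr.
case: (leP (wait_first_block N (N.+1 * m)%N (N * m)%N)) => _.
  have [g' [lg' g'0 g'n ag']] := append_walk lg lfirst erefl.
  exists g'; split=> //; rewrite ?g'0 ?g'n ?ag' ?gn//.
have [g' [lg' g'0 g'n ag']] := append_walk lg llast (congr1 Posz (min0n N)).
exists g'; split=> //; rewrite ?g'0 ?g'n ?ag' ?gn ?PoszD//.
by rewrite (minn_idPr (leqnSn N)).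
Qed.

End Walks.

(** * Bounded random variables and their means *)

Section BoundedExpectation.
Set Implicit Arguments.
Unset Strict Implicit.
Unset Printing Implicit Defensive.
Context {R : realType} {d : measure_display} {T : measurableType d}.
Variable P : probability T R.
Implicit Types X Y : T -> R.

(** The bound is required at every outcome, so that integrability is automatic and means can be
    compared pointwise. *)
Definition bounded_rv X :=
  measurable_fun setT X /\ exists M, forall w, `|X w| <= M.

Definition mean X : R := \int[P]_w X w.

Lemma bounded_rv_integrable X : bounded_rv X -> P.-integrable setT (EFin \o X).
Proof.
move=> [mX [M XM]]; apply: measurable_bounded_integrable => //.
  exact: le_lt_trans (probability_le1 P measurableT) (ltry 1).
by exists M; split; [exact: num_real|move=> x Mx w _; exact: le_trans (XM w) (ltW Mx)].
Qed.

Lemma bounded_rv_cst (r : R) : bounded_rv (fun=> r).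
Proof. by split=> //; exists `|r|. Qed.

Lemma bounded_rvD X Y : bounded_rv X -> bounded_rv Y ->
  bounded_rv (fun w => X w + Y w).
Proof.
move=> [mX [M XM]] [mY [N YN]]; split; first exact: measurable_funD.
by exists (M + N) => w; apply: le_trans (ler_normD _ _) _; exact: lerD.
Qed.

Lemma bounded_rvM X Y : bounded_rv X -> bounded_rv Y ->
  bounded_rv (fun w => X w * Y w).
Proof.
move=> [mX [M XM]] [mY [N YN]]; split; first exact: measurable_funM.
by exists (M * N) => w; rewrite normrM; exact: ler_pM.
Qed.

Lemma bounded_rvN X : bounded_rv X -> bounded_rv (fun w => - X w).
Proof.
move=> [mX [M XM]]; split; first exact: measurableT_comp.
by exists M => w; rewrite normrN.
Qed.

Lemma bounded_rvB X Y : bounded_rv X -> bounded_rv Y ->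
  bounded_rv (fun w => X w - Y w).
Proof. by move=> bX bY; apply: bounded_rvD => //; exact: bounded_rvN. Qed.

Lemma bounded_rv_norm X : bounded_rv X -> bounded_rv (fun w => `|X w|).
Proof.
move=> [mX [M XM]]; split; first exact: measurableT_comp.
by exists M => w; rewrite normr_id.
Qed.

Lemma bounded_rvX X n : bounded_rv X -> bounded_rv (fun w => X w ^+ n).
Proof.
move=> [mX [M XM]]; split; first exact: measurable_funX.
by exists (M ^+ n) => w; rewrite normrX lerXn2r// nnegrE// (le_trans _ (XM w)).
Qed.

Lemma bounded_rv_sum I (s : seq I) (p : pred I) (X : I -> T -> R) :
  (forall i, bounded_rv (X i)) -> bounded_rv (fun w => \sum_(i <- s | p i) X i w).
Proof.
move=> bX; elim: s => [|i s IHs].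
  by rewrite (_ : (fun _ => _) = fun=> 0);
    [exact: bounded_rv_cst|apply/funext => w; rewrite big_nil].
rewrite (_ : (fun _ => _) = fun w => (if p i then X i w else 0) +
    \sum_(j <- s | p j) X j w).
  by apply: bounded_rvD => //; case: (p i) => //; exact: bounded_rv_cst.
by apply/funext => w; rewrite big_cons; case: (p i) => //; rewrite add0r.
Qed.

Lemma mean_cst (r : R) : mean (fun=> r) = r.
Proof.
rewrite /mean Rintegral_cst// -[RHS]mulr1; congr (_ * _).
exact: (congr1 fine (probability_setT P)).
Qed.

Lemma meanD X Y : bounded_rv X -> bounded_rv Y ->
  mean (fun w => X w + Y w) = mean X + mean Y.
Proof. by move=> bX bY; apply: RintegralD => //; exact: bounded_rv_integrable. Qed.

Lemma meanB X Y : bounded_rv X -> bounded_rv Y ->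
  mean (fun w => X w - Y w) = mean X - mean Y.
Proof. by move=> bX bY; apply: RintegralB => //; exact: bounded_rv_integrable. Qed.

Lemma meanZ (r : R) X : bounded_rv X -> mean (fun w => r * X w) = r * mean X.
Proof. by move=> bX; apply: RintegralZl => //; exact: bounded_rv_integrable. Qed.

Lemma meanN X : bounded_rv X -> mean (fun w => - X w) = - mean X.
Proof.
move=> bX; rewrite -mulN1r -meanZ//; congr mean.
by apply/funext => w; rewrite mulN1r.
Qed.

Lemma le_mean X Y : bounded_rv X -> bounded_rv Y -> (forall w, X w <= Y w) ->
  mean X <= mean Y.
Proof. by move=> bX bY XY; apply: le_Rintegral => //; exact: bounded_rv_integrable. Qed.

Lemma mean_sum I (s : seq I) (p : pred I) (X : I -> T -> R) :
  (forall i, bounded_rv (X i)) ->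
  mean (fun w => \sum_(i <- s | p i) X i w) = \sum_(i <- s | p i) mean (X i).
Proof.
move=> bX; elim: s => [|i s IHs].
  by rewrite big_nil -[RHS](mean_cst 0); congr mean; apply/funext => w; rewrite big_nil.
rewrite big_cons -IHs; case: ifP => pi.
  rewrite -meanD//; last exact: bounded_rv_sum.
  by congr mean; apply/funext => w; rewrite big_cons pi.
by congr mean; apply/funext => w; rewrite big_cons pi.
Qed.

(** Markov's inequality: [X] dominates [a] times the indicator of [A]. *)
Lemma mean_ge_prob X (A : set T) (a : R) : bounded_rv X -> (forall w, 0 <= X w) ->
  measurable A -> (forall w, A w -> a <= X w) -> a * fine (P A) <= mean X.
Proof.
move=> bX X0 mA aX.
have bA : bounded_rv (\1_A : T -> R).
  split=> //; exists 1 => w; rewrite indicE.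
  by case: (w \in A); rewrite ?normr1 ?normr0.
have <- : mean (\1_A : T -> R) = fine (P A).
  by rewrite /mean /Rintegral integral_indic// setIT.
rewrite -meanZ//; apply: le_mean => //.
  by apply: bounded_rvM => //; exact: bounded_rv_cst.
move=> w; rewrite indicE; case: (asboolP (A w)) => Aw.
  by rewrite mem_set// mulr1 aX.
by rewrite memNset// mulr0.
Qed.

(** Since the limit is deterministic, a bound on it may be read off at a single outcome; this
    provides one inside a given event of positive probability. *)
Lemma ae_exists (A : set T) (Q : T -> Prop) : measurable A -> (0 < P A)%E ->
  {ae P, forall w, Q w} -> exists2 w, A w & Q w.
Proof.
move=> mA PA [N [mN N0 QN]].
apply: contrapT => nex.
have AN : A `<=` N.
  by move=> w Aw; apply: QN => /= Qw; apply: nex; exists w.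
have : (P A <= P N)%E by apply: le_measure; rewrite ?inE.
by rewrite N0 leNgt PA.
Qed.

(* Truncating [Z n] at the level [L] makes dominated convergence applicable. *)
Lemma le_of_eventual_mean (Z : nat -> T -> R) (C L u : R) :
  (forall n, measurable_fun setT (Z n)) ->
  (forall n w, `|Z n w| <= C) ->
  {ae P, forall w, forall e, 0 < e -> \forall n \near \oo, L - e <= Z n w} ->
  (\forall n \near \oo, mean (Z n) <= u) -> L <= u.
Proof.
move=> mZ ZC ZL Zu.
have bZ n : bounded_rv (Z n) by split=> //; exists C; exact: ZC.
pose V n w := Num.min (Z n w) L.
have Vbound n w : `|V n w| <= C + `|L|.
  rewrite /V; have [_|_] := leP (Z n w) L.
    by apply: le_trans (ZC n w) _; rewrite lerDl.
  by rewrite lerDr; apply: le_trans (ZC n w).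
have bV n : bounded_rv (V n).
  by split; [exact: measurable_minr|exists (C + `|L|)].
have VL : {ae P, forall w, setT w -> (EFin \o V n) w @[n --> \oo] --> L%:E}.
  apply: filterS ZL => w Zw _; apply: cvg_EFin; first exact: nearW.
  apply/cvgrPdist_le => e e0.
  apply: filterS (Zw e e0) => n Ln.
  rewrite /= /V ger0_norm ?subr_ge0 ?ge_min ?lexx ?orbT//.
  rewrite lerBlDr -lerBlDl le_min Ln /=; lra.
have [_ _] := dominated_convergence (mu := P) measurableT
  (fun n => measurable_int _ (bounded_rv_integrable (bV n)))
  (measurable_cst L%:E) VL
  (bounded_rv_integrable (bounded_rv_cst (C + `|L|)))
  (aeW P (fun w n _ => Vbound n w)).
have -> : (\int[P]_w L%:E)%E = L%:E.
  by rewrite integral_cst// -[RHS]mule1; congr (_ * _)%E; exact: (probability_setT P).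
move=> /fine_cvg cV.
apply: (cvgr_to_le cV).
apply: filterS Zu => n; apply: le_trans; apply: le_mean => // w.
by rewrite /V ge_min lexx.
Qed.

End BoundedExpectation.

(** * A fair sign independent of the other variables *)

Section IndependentSign.
Set Implicit Arguments.
Unset Strict Implicit.
Unset Printing Implicit Defensive.
Context {R : realType} {d : measure_display} {T : measurableType d}.
Variables (P : probability T R) (I : eqType) (X : I -> {RV P >-> R}).
Hypothesis X_indep : mutually_independent X.
Variables (i0 : I) (A0 : set R).
Hypotheses (mA0 : measurable A0) (PA0 : P (X i0 @^-1` A0) = (1 / 2)%:E).

(** A pi-system generating the sigma-algebra of all [X i] with [i] different from [i0]. Giving [A]
    on every index, with [setT] outside [J], makes intersections pointwise. *)
Definition cylinders_off : set (set T) :=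
  [set C | exists J : seq I, exists A : I -> set R,
    [/\ i0 \notin J, forall i, measurable (A i), forall i, i \notin J -> A i = setT
      & C = [set w | forall i, A i (X i w)]]].

Lemma preimage_cylinders_off i (A : set R) : i != i0 -> measurable A ->
  cylinders_off (X i @^-1` A).
Proof.
move=> ii0 mA; exists [:: i], (fun j => if j == i then A else setT); split.
- by rewrite mem_seq1 eq_sym.
- by move=> j; case: ifP.
- by move=> j; rewrite mem_seq1 => /negbTE ->.
- apply/seteqP; split=> w /=.
    by move=> Aw j; case: eqP => [->|].
  by move=> /(_ i); rewrite eqxx.
Qed.

Lemma cylinders_off_setI : setI_closed cylinders_off.
Proof.
move=> _ _ [J [A [iJ mA AT ->]]] [K [B [iK mB BT ->]]].
exists (J ++ K), (fun i => A i `&` B i); split.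
- by rewrite mem_cat negb_or iJ iK.
- by move=> i; exact: measurableI.
- by move=> i; rewrite mem_cat negb_or => /andP[/AT -> /BT ->]; rewrite setTI.
- apply/seteqP; split=> w /=; first by move=> [Aw Bw] i; split.
  by move=> ABw; split=> i; have [] := ABw i.
Qed.

(** Removing repetitions from [J] matches the form of [mutually_independent], which speaks of
    duplicate-free lists. *)
Lemma cylinder_bigcap (J : seq I) (A : I -> set R) :
  (forall i, i \notin J -> A i = setT) ->
  [set w | forall i, A i (X i w)] = \bigcap_(i in [set` undup J]) X i @^-1` A i.
Proof.
move=> AT; apply/seteqP; split=> w /=; first by move=> Aw i _; exact: Aw.
move=> Aw i; have [iJ|/AT -> //] := boolP (i \in J).
by apply: Aw; rewrite /= mem_undup.
Qed.

Lemma cylinders_off_measurable : cylinders_off `<=` measurable.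
Proof.
move=> _ [J [A [_ mA AT ->]]]; rewrite (cylinder_bigcap AT).
apply: fin_bigcap_measurable => // i _.
by rewrite -[X in measurable X]setTI; exact: measurable_funP.
Qed.

Lemma probability_cylinderI (J : seq I) (A : I -> set R) (B : set R) :
  i0 \notin J -> (forall i, measurable (A i)) ->
  (forall i, i \notin J -> A i = setT) -> measurable B ->
  P ([set w | forall i, A i (X i w)] `&` X i0 @^-1` B) =
  (P (X i0 @^-1` B) * \prod_(i <- undup J) P (X i @^-1` A i))%E.
Proof.
move=> iJ mA AT mB; pose A' i := if i == i0 then B else A i.
have iJ' : i0 \notin undup J by rewrite mem_undup.
have -> : [set w | forall i, A i (X i w)] `&` X i0 @^-1` B =
    \bigcap_(i in [set` i0 :: undup J]) X i @^-1` A' i.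
  apply/seteqP; split=> w /=.
    move=> [Aw Bw] i _; rewrite /preimage /A' /=.
    by case: eqP => [->|_] //; exact: Aw.
  move=> A'w; split=> [i|]; last first.
    by have := A'w i0; rewrite /= /A' mem_head eqxx; exact.
  have [iJ1|/AT -> //] := boolP (i \in J).
  have := A'w i; rewrite /= /A' in_cons mem_undup iJ1 orbT => /(_ erefl).
  by case: eqP iJ1 => // ->; rewrite (negbTE iJ).
rewrite X_indep /= ?iJ' ?undup_uniq//; last by move=> i; rewrite /A'; case: ifP.
rewrite big_cons {1}/A' eqxx; congr (_ * _)%E.
apply: eq_big_seq => i iJ1; rewrite /A'.
by case: eqP iJ1 => // ->; rewrite (negbTE iJ').
Qed.

(** Both sides are finite measures of [C]. On cylinders they agree by the product formula, since
    [A0] and its complement both have probability one half; uniqueness of measures on a pi-system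
    extends this to the generated sigma-algebra. *)
Lemma independent_half (C : set T) : <<s cylinders_off >> C ->
  P (C `&` X i0 @^-1` A0) = P (C `&` X i0 @^-1` (~` A0)).
Proof.
have mD (B : set R) (mB : measurable B) : measurable (X i0 @^-1` B).
  by rewrite -[X in measurable X]setTI; exact: measurable_funP.
have mA0C := measurableC mA0.
have PA0C : P (X i0 @^-1` (~` A0)) = (1 / 2)%:E.
  rewrite preimage_setC probability_setC; last exact: mD.
  by rewrite PA0 -EFinB; congr EFin; lra.
apply: (@g_sigma_algebra_measure_unique _ _ _ cylinders_off _ (fun=> setT) _ _
  (mrestr P (mD _ mA0)) (mrestr P (mD _ mA0C))).
- exact: cylinders_off_measurable.
- move=> _; exists [::], (fun=> setT); split=> //.
  by apply/seteqP; split.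
- by apply: bigcup_const; exists 0%N.
- exact: cylinders_off_setI.
- move=> _ [J [A [iJ mA AT ->]]]; rewrite /= /mrestr.
  by rewrite !(probability_cylinderI iJ)// PA0 PA0C.
- move=> _; rewrite /= /mrestr setTI PA0; exact: ltry.
Qed.

(** Equal to plus or minus one at every outcome, so that case analysis on the sign is always
    possible. *)
Definition sign_rv (w : T) : R := if X i0 w \in A0 then 1 else -1.

Lemma sign_rvE w : sign_rv w = 1 \/ sign_rv w = -1.
Proof. by rewrite /sign_rv; case: ifP; [left|right]. Qed.

Lemma bounded_sign_rv : bounded_rv sign_rv.
Proof.
split; last by exists 1 => w; have [->|->] := sign_rvE w; rewrite ?normrN normr1.
have -> : sign_rv = fun w => 2 * \1_A0 (X i0 w) - 1.
  apply/funext => w; rewrite /sign_rv indicE; case: (_ \in _) => /=; lra.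
apply: measurable_funB => //; apply: measurable_funM => //.
by apply: measurableT_comp => //; exact: measurable_indic.
Qed.

(** The product [Z] of the sign and [Y] has a symmetric law, so its mean equals its opposite.
    Working with laws reduces everything to probabilities of events, where [independent_half]
    applies. *)
Lemma mean_sign_mul (Y : T -> R) : bounded_rv Y ->
  measurable_fun setT (Y : g_sigma_algebraType cylinders_off -> R) ->
  mean P (fun w => sign_rv w * Y w) = 0.
Proof.
move=> bY mY.
pose Z w := sign_rv w * Y w.
have bZ : bounded_rv Z by apply: bounded_rvM => //; exact: bounded_sign_rv.
have mYC (A : set R) : measurable A -> <<s cylinders_off >> (Y @^-1` A).
  by move=> mA; have := mY measurableT A mA; rewrite setTI.
have mYA (A : set R) (mA : measurable A) : measurable (Y @^-1` A).
  by rewrite -[X in measurable X]setTI; exact: (bY.1 measurableT).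
have mD (B : set R) (mB : measurable B) : measurable (X i0 @^-1` B).
  by rewrite -[X in measurable X]setTI; exact: measurable_funP.
have mA0C := measurableC mA0.
(* Used with [s = 1] for [Z] and with [s = -1] for [- Z]. *)
have split_sign (W : T -> R) (A : set R) (s : R) : measurable A ->
    (forall w, A0 (X i0 w) -> W w = s * Y w) ->
    (forall w, ~ A0 (X i0 w) -> W w = - s * Y w) ->
    P (W @^-1` A) = (P ((Y @^-1` ( *%R s @^-1` A)) `&` X i0 @^-1` A0) +
                     P ((Y @^-1` ( *%R (- s) @^-1` A)) `&` X i0 @^-1` (~` A0)))%E.
  move=> mA W1 W2.
  have mM r : measurable ( *%R r @^-1` A).
    by rewrite -[X in measurable X]setTI; exact: mulrl_measurable.
  transitivity (P ((Y @^-1` ( *%R s @^-1` A)) `&` X i0 @^-1` A0 `|`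
      (Y @^-1` ( *%R (- s) @^-1` A)) `&` X i0 @^-1` (~` A0))); last first.
    rewrite measureU//.
    - by apply: measurableI; [exact: mYA|exact: mD].
    - by apply: measurableI; [exact: mYA|exact: mD].
    - by apply/seteqP; split=> w //= [[_ ?] [_ ]].
  apply: congr1; apply/seteqP; split=> w /=.
    have [Aw|nAw] := pselect (A0 (X i0 w)); first by rewrite W1//; left.
    by rewrite W2//; right.
  by move=> [[/= Aw /W1 ->]|[/= Aw /W2 ->]].
have symZ (A : set R) : measurable A ->
    P (Z @^-1` A) = P ((fun w => - Z w) @^-1` A).
  move=> mA.
  have mM r : measurable ( *%R r @^-1` A).
    by rewrite -[X in measurable X]setTI; exact: mulrl_measurable.
  have Zin w : A0 (X i0 w) -> Z w = 1 * Y w by move=> Aw; rewrite /Z /sign_rv mem_set.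
  have Zout w : ~ A0 (X i0 w) -> Z w = -1 * Y w.
    by move=> nAw; rewrite /Z /sign_rv memNset.
  rewrite (split_sign Z A 1)// (split_sign (fun w => - Z w) A (-1))//; first last.
  - by move=> w /Zout ->; rewrite mulN1r !opprK mul1r.
  - by move=> w /Zin ->; rewrite mul1r mulN1r.
  (* The two decompositions contain the same events of [Y], paired with opposite signs;
     [independent_half] exchanges the signs. *)
  rewrite opprK (independent_half (mYC _ (mM 1))).
  by rewrite (independent_half (mYC _ (mM (-1)))) addeC.
(* The mean depends on the law only. *)
have EZ (W : T -> R) : bounded_rv W -> mean P W = fine (\int[pushforward P W]_y y%:E)%E.
  move=> bW; rewrite integral_pushforward//.
  - exact: bW.1.
  - exact: bounded_rv_integrable.
have : mean P Z = mean P (fun w => - Z w).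
  rewrite !EZ//; last exact: bounded_rvN.
  congr fine; apply: eq_measure_integral.
  - exact: (bounded_rvN bZ).1.
  - exact: bZ.1.
  - by move=> ? ? A mA _; exact: symZ.
by rewrite meanN// -/Z; lra.
Qed.

End IndependentSign.

(** * The model with signs and potential bounded at every outcome *)

Section Model.
Set Implicit Arguments.
Unset Strict Implicit.
Unset Printing Implicit Defensive.
Context {R : realType} {d : measure_display} {T : measurableType d}.
Variables (P : probability T R) (c : R) (b f : int -> T -> R).
Variable G : int -> set (set T).
Hypotheses (c0 : 0 < c) (b_sign : forall i w, b i w = 1 \/ b i w = -1)
  (b_rv : forall i, bounded_rv (b i)) (f_rv : forall x, bounded_rv (f x))
  (f_lec : forall x w, `|f x w| <= c).

(** In the application [G i] consists of the cylinders avoiding the sign [i], so such a [Y] is a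
    function of the other variables and [mean_bM] removes its product with [b i]. *)
Definition off i (Y : T -> R) :=
  bounded_rv Y /\ measurable_fun setT (Y : g_sigma_algebraType (G i) -> R).

Hypotheses (f_off : forall i x, off i (f x))
  (b_off : forall i j, j != i -> off i (b j))
  (mean_bM : forall i Y, off i Y -> mean P (fun w => b i w * Y w) = 0).

Let b_norm i w : `|b i w| = 1.
Proof. by have [->|->] := b_sign i w; rewrite ?normrN normr1. Qed.

Let b_le1 i w : `|b i w| <= 1.
Proof. by rewrite b_norm. Qed.

Lemma off_cst i r : off i (fun=> r).
Proof. by split; [exact: bounded_rv_cst|exact: measurable_cst]. Qed.

Lemma offD i X Y : off i X -> off i Y -> off i (fun w => X w + Y w).
Proof.
by move=> [bX mX] [bY mY]; split; [exact: bounded_rvD|exact: measurable_funD].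
Qed.

Lemma offB i X Y : off i X -> off i Y -> off i (fun w => X w - Y w).
Proof.
by move=> [bX mX] [bY mY]; split; [exact: bounded_rvB|exact: measurable_funB].
Qed.

Lemma offM i X Y : off i X -> off i Y -> off i (fun w => X w * Y w).
Proof.
by move=> [bX mX] [bY mY]; split; [exact: bounded_rvM|exact: measurable_funM].
Qed.

Lemma offX i X n : off i X -> off i (fun w => X w ^+ n).
Proof.
by move=> [bX mX]; split; [exact: bounded_rvX|exact: measurable_funX].
Qed.

Lemma mean_bf i x : mean P (fun w => b i w * f x w) = 0.
Proof. exact: (mean_bM (f_off i x)). Qed.

(** * Second and fourth moments of the block gap *)

Let incr x w := f (x + 1) w - f x w.
Let gap N t x w := block_gap (b ^~ w) (f ^~ w) N t x.

Let off_incr i x : off i (incr x).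
Proof. exact: offB. Qed.

Let incr_norm x w : `|incr x w| <= 2 * c.
Proof.
apply: le_trans (ler_normB _ _) _; rewrite mulr2n mulrDl mul1r; exact: lerD.
Qed.

Let gapS N t x w :
  gap N.+1 t x w = gap N t x w + b (t + N.+1%:Z) w * incr (x + N%:Z) w.
Proof.
rewrite /gap /block_gap big_ord_recr/= /incr.
by rewrite (_ : x + N.+1%:Z = x + N%:Z + 1)//; lia.
Qed.

Let gap0 t x w : gap 0 t x w = 0.
Proof. by rewrite /gap /block_gap big_ord0. Qed.

(** Only the signs at times [t + 1, ..., t + N] enter the gap. This is the martingale structure
    behind the moment recursions. *)
Let off_gap i N t x : t + N%:Z < i -> off i (gap N t x).
Proof.
elim: N => [|N IHN] tNi.
  rewrite (_ : gap 0 t x = fun=> 0); first exact: off_cst.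
  by apply/funext => w; rewrite gap0.
rewrite (_ : gap N.+1 t x = fun w => gap N t x w +
    b (t + N.+1%:Z) w * incr (x + N%:Z) w); last by apply/funext => w; rewrite gapS.
apply: offD; first by apply: IHN; lia.
by apply: offM => //; apply: b_off; lia.
Qed.

Let bounded_gap N t x : bounded_rv (gap N t x).
Proof. by have [] := @off_gap (t + N%:Z + 1) N t x ltac:(lia). Qed.

Let bounded_incr x : bounded_rv (incr x).
Proof. by have [] := off_incr 0 x. Qed.

(** As the square of a sign is one, expanding leaves [S ^ 2 + D ^ 2] plus a cross term with the
    factor [b i], whose mean is zero. *)
Let mean_gapS2 N t x : mean P (fun w => gap N.+1 t x w ^+ 2) =
  mean P (fun w => gap N t x w ^+ 2) + mean P (fun w => incr (x + N%:Z) w ^+ 2).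
Proof.
pose S := gap N t x; pose D := incr (x + N%:Z); pose i := t + N.+1%:Z.
have oS : off i S by apply: off_gap; rewrite /i; lia.
have oD : off i D by exact: off_incr.
have oSD : off i (fun w => 2 * (S w * D w)).
  by apply: offM; [exact: off_cst|exact: offM].
have -> : (fun w => gap N.+1 t x w ^+ 2) =
    fun w => (S w ^+ 2 + D w ^+ 2) + b i w * (2 * (S w * D w)).
  apply/funext => w; rewrite gapS -/(S w) -/(D w) -/i.
  by have [->|->] := b_sign i w; ring.
have bS2 := bounded_rvX 2 oS.1; have bD2 := bounded_rvX 2 oD.1.
rewrite meanD ?mean_bM ?addr0 ?meanD//; first exact: bounded_rvD.
by apply: bounded_rvM => //; exact: oSD.1.
Qed.

(** Odd powers of the new sign collect into one term of mean zero; even powers of it are one. *)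
Let mean_gapS4 N t x : mean P (fun w => gap N.+1 t x w ^+ 4) =
  mean P (fun w => gap N t x w ^+ 4) +
  mean P (fun w => 6 * (gap N t x w ^+ 2 * incr (x + N%:Z) w ^+ 2)) +
  mean P (fun w => incr (x + N%:Z) w ^+ 4).
Proof.
pose S := gap N t x; pose D := incr (x + N%:Z); pose i := t + N.+1%:Z.
have oS : off i S by apply: off_gap; rewrite /i; lia.
have oD : off i D by exact: off_incr.
have oSD : off i (fun w => 4 * (S w ^+ 3 * D w) + 4 * (S w * D w ^+ 3)).
  apply: offD; (apply: offM; first exact: off_cst); apply: offM => //; exact: offX.
have oS2D2 : off i (fun w => 6 * (S w ^+ 2 * D w ^+ 2)).
  by apply: offM; [exact: off_cst|apply: offM; exact: offX].
have -> : (fun w => gap N.+1 t x w ^+ 4) =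
    fun w => (S w ^+ 4 + 6 * (S w ^+ 2 * D w ^+ 2) + D w ^+ 4) +
      b i w * (4 * (S w ^+ 3 * D w) + 4 * (S w * D w ^+ 3)).
  apply/funext => w; rewrite gapS -/(S w) -/(D w) -/i.
  by have [->|->] := b_sign i w; ring.
have bS4 := bounded_rvX 4 oS.1; have bD4 := bounded_rvX 4 oD.1.
have bSD := bounded_rvM (b_rv i) oSD.1.
have b1 := bounded_rvD bS4 oS2D2.1.
by rewrite (meanD P (bounded_rvD b1 bD4) bSD) mean_bM// addr0 (meanD P b1 bD4)
  (meanD P bS4 oS2D2.1).
Qed.

Let incr_sqr_le x w : incr x w ^+ 2 <= 4 * c ^+ 2.
Proof.
rewrite -real_normK ?num_real//.
have -> : 4 * c ^+ 2 = (2 * c) ^+ 2 by ring.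
by rewrite lerXn2r// nnegrE// mulr_ge0// ltW.
Qed.

Let mean_gap2_ge v N t x :
  (forall x, v <= mean P (fun w => (f (x + 1) w - f x w) ^+ 2)) ->
  v * N%:R <= mean P (fun w => gap N t x w ^+ 2).
Proof.
move=> v_le; elim: N => [|N IHN].
  rewrite mulr0 (_ : (fun _ => _) = fun=> 0) ?mean_cst//.
  by apply/funext => w; rewrite gap0 expr0n.
by rewrite mean_gapS2 -[N.+1%:R]natr1 mulrDr mulr1 lerD//; exact: v_le.
Qed.

Let mean_gap2_le N t x : mean P (fun w => gap N t x w ^+ 2) <= 4 * c ^+ 2 * N%:R.
Proof.
elim: N => [|N IHN].
  rewrite mulr0 (_ : (fun _ => _) = fun=> 0) ?mean_cst//.
  by apply/funext => w; rewrite gap0 expr0n.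
rewrite mean_gapS2 -[N.+1%:R]natr1 mulrDr mulr1 lerD// -[leRHS](mean_cst P).
apply: le_mean => //; [exact: bounded_rvX|exact: bounded_rv_cst].
Qed.

Let mean_gap4_le N t x :
  mean P (fun w => gap N t x w ^+ 4) <= 48 * c ^+ 4 * N%:R ^+ 2.
Proof.
elim: N => [|N IHN].
  rewrite expr0n mulr0 (_ : (fun _ => _) = fun=> 0) ?mean_cst//.
  by apply/funext => w; rewrite gap0 expr0n.
rewrite mean_gapS4.
have bS2 := bounded_rvX 2 (bounded_gap N t x).
have bD2 := bounded_rvX 2 (bounded_incr (x + N%:Z)).
have b6 : bounded_rv (fun w => 6 * (gap N t x w ^+ 2 * incr (x + N%:Z) w ^+ 2)).
  by apply: bounded_rvM; [exact: bounded_rv_cst|exact: bounded_rvM].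
have b24 : bounded_rv (fun w => 24 * c ^+ 2 * gap N t x w ^+ 2).
  by apply: bounded_rvM => //; exact: bounded_rv_cst.
have h6 : mean P (fun w => 6 * (gap N t x w ^+ 2 * incr (x + N%:Z) w ^+ 2)) <=
    24 * c ^+ 2 * (4 * c ^+ 2 * N%:R).
  apply: (@le_trans _ _ (mean P (fun w => 24 * c ^+ 2 * gap N t x w ^+ 2))).
    apply: le_mean => // w.
    have := ler_wpM2l (sqr_ge0 (gap N t x w)) (incr_sqr_le (x + N%:Z) w); lra.
  rewrite meanZ//; apply: ler_wpM2l; last exact: mean_gap2_le.
  by have := sqr_ge0 c; lra.
have h4 : mean P (fun w => incr (x + N%:Z) w ^+ 4) <= 16 * c ^+ 4.
  rewrite -[leRHS](mean_cst P).
  apply: le_mean => [||w]; [exact: bounded_rvX|exact: bounded_rv_cst|].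
  have -> : 16 * c ^+ 4 = (4 * c ^+ 2) * (4 * c ^+ 2) by ring.
  have -> : incr (x + N%:Z) w ^+ 4 = incr (x + N%:Z) w ^+ 2 * incr (x + N%:Z) w ^+ 2 by ring.
  by apply: ler_pM; rewrite ?sqr_ge0 ?incr_sqr_le.
have c4 : 0 <= c ^+ 4 by rewrite exprn_ge0// ltW.
rewrite -[N.+1%:R]natr1.
(* The constant 48 is chosen so that the increment of [48 c^4 N^2], which is [96 c^4 N + 48 c^4],
   covers the mixed term [96 c^4 N] and the last term [16 c^4]. *)
have -> : 48 * c ^+ 4 * (N%:R + 1) ^+ 2 =
  48 * c ^+ 4 * N%:R ^+ 2 + 24 * c ^+ 2 * (4 * c ^+ 2 * N%:R) + 48 * c ^+ 4 by ring.
apply: lerD; first exact: lerD.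
by apply: le_trans h4 _; lra.
Qed.

(* The pointwise bound [`|s| >= 3/2 s^2 - 1/2 s^4] at [s = X w / r]. *)
Lemma mean_norm_ge (X : T -> R) (r : R) : bounded_rv X -> 0 < r ->
  3 / (2 * r) * mean P (fun w => X w ^+ 2) -
  1 / (2 * r ^+ 3) * mean P (fun w => X w ^+ 4) <= mean P (fun w => `|X w|).
Proof.
move=> bX r0; have b2 := bounded_rvX 2 bX; have b4 := bounded_rvX 4 bX.
rewrite -!meanZ// -meanB; try by apply: bounded_rvM => //; exact: bounded_rv_cst.
apply: le_mean => [||w]; last 1 first.
- pose s := `|X w| / r.
  have s0 : 0 <= s by rewrite divr_ge0// ltW.
  have Xs : `|X w| = r * s by rewrite /s mulrC divfK// gt_eqF.
  have -> : X w ^+ 4 = (X w ^+ 2) ^+ 2 by ring.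
  rewrite -(real_normK (num_real (X w))) Xs -subr_ge0.
  have -> : r * s - (3 / (2 * r) * (r * s) ^+ 2 - 1 / (2 * r ^+ 3) * ((r * s) ^+ 2) ^+ 2) =
    r / 2 * (s * ((s - 1) ^+ 2 * (s + 2))) by field; rewrite gt_eqF.
  apply: mulr_ge0; first by rewrite divr_ge0// ltW.
  by rewrite mulr_ge0// mulr_ge0 ?sqr_ge0// addr_ge0.
- by apply: bounded_rvB; apply: bounded_rvM => //; exact: bounded_rv_cst.
- exact: bounded_rv_norm.
Qed.

(** Take [N = k ^ 2], whose square root is an integer, and apply [mean_norm_ge] at the scale
    [r = l * k]: the second moment contributes order [k / l] and the fourth takes away order
    [k / l ^ 3], so a large constant [l] leaves a bound linear in [k]. It is uniform in the position
    of the block. *)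
Lemma mean_gap_unbounded (v M : R) : 0 < v ->
  (forall x, v <= mean P (fun w => (f (x + 1) w - f x w) ^+ 2)) ->
  exists N : nat, (0 < N)%N /\ forall t x, M <= mean P (fun w => `|gap N t x w|).
Proof.
move=> v0 v_le; have c4 : 0 < c ^+ 4 by exact: exprn_gt0.
(* With this choice [24 c^4 = (l - 1) v], and the final comparison becomes
   [l ^ 2 - (l - 1) >= 0]. *)
pose l := 1 + 24 * c ^+ 4 / v.
have l1 : 1 <= l by rewrite lerDl divr_ge0// ?mulr_ge0// ltW.
have l0 : 0 < l by exact: lt_le_trans l1.
pose k := (Num.truncn (2 * l * `|M| / v)).+1.
have k0 : (0 : R) < k%:R by rewrite ltr0n.
have Mk : M <= k%:R * (v / (2 * l)).
  rewrite mulrA ler_pdivlMr ?mulr_gt0//.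
  apply: (@le_trans _ _ (2 * l * `|M|)).
    by rewrite mulrC ler_wpM2l ?ler_norm// mulr_ge0// ltW.
  by rewrite -ler_pdivrMr// ltW// truncnS_gt.
exists (k ^ 2)%N; split; first by rewrite expn_gt0.
move=> t x; apply: le_trans Mk _.
have lk0 : 0 < l * k%:R by exact: mulr_gt0.
apply: le_trans (mean_norm_ge (bounded_gap _ _ _) lk0).
have h2 := mean_gap2_ge (k ^ 2) t x v_le; have h4 := mean_gap4_le (k ^ 2) t x.
rewrite natrX in h2 h4.
apply: (@le_trans _ _ (3 / (2 * (l * k%:R)) * (v * k%:R ^+ 2) -
    1 / (2 * (l * k%:R) ^+ 3) * (48 * c ^+ 4 * (k%:R ^+ 2) ^+ 2))); last first.
  apply: lerB; apply: ler_wpM2l => //.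
    by rewrite divr_ge0// mulr_ge0// ltW.
  by rewrite divr_ge0// mulr_ge0// exprn_ge0// ltW.
rewrite -subr_ge0.
have -> : 3 / (2 * (l * k%:R)) * (v * k%:R ^+ 2) -
    1 / (2 * (l * k%:R) ^+ 3) * (48 * c ^+ 4 * (k%:R ^+ 2) ^+ 2) -
    k%:R * (v / (2 * l)) = k%:R * v / l ^+ 3 * (l ^+ 2 - (l - 1)).
  by rewrite /l; field; rewrite !gt_eqF//; lra.
apply: mulr_ge0; first by rewrite divr_ge0 ?mulr_ge0 ?exprn_ge0// ltW.
by nra.
Qed.

(** * Bounds on the shape function at zero, at one and along a line *)

Variable Lambda : R -> R.
Hypotheses
  (shape : {ae P, forall w, forall a : R, -1 <= a <= 1 ->
     (fun n : nat => min_action (b ^~ w) (f ^~ w) n (round_to_zero (a * n%:R)) / n%:R)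
       @ \oo --> - Lambda a})
  (opposite_neighbours : forall s, 0 <= s < c -> exists2 p : R, 0 < p & forall x,
     p <= fine (P ([set w | s <= f x w] `&` [set w | f (x + 1) w <= - s])))
  (small_values : exists2 p : R, 0 < p & forall x, p <= fine (P [set w | `|f x w| <= c / 2])).

Lemma round_to_zero_nat (k : nat) : round_to_zero (k%:R : R) = k%:Z.
Proof. by rewrite /round_to_zero ler0n pmulrn intrKfloor. Qed.

Lemma measurable_rv_le (X Y : T -> R) : measurable_fun setT X -> measurable_fun setT Y ->
  measurable [set w | X w <= Y w].
Proof.
move=> mX mY; rewrite -[X in measurable X]setTI.
exact: (measurable_fun_le measurableT mX mY).
Qed.

Let mopp x s : measurable ([set w | s <= f x w] `&` [set w | f (x + 1) w <= - s]).
Proof.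
apply: measurableI; apply: measurable_rv_le => //; exact: (f_rv _).1.
Qed.

(** For each [s < c], one outcome with [f 0 >= s] and [f 1 <= - s] at which the convergence holds
    suffices: there the two-site walk has action at most [- s n + (c + s)]. Then [s] tends to
    [c]. *)
Lemma shape0_ge : c <= Lambda 0.
Proof.
suff H s : 0 <= s < c -> s <= Lambda 0.
  apply/ler_addgt0Pr => e e0; case: (ltP e c) => ec; last first.
    have [] := H 0 ltac:(by rewrite lexx c0) => //; lra.
  by have := H (c - e) ltac:(lra); lra.
move=> sc; have [p p0 /(_ 0) pP] := opposite_neighbours sc.
set A := _ `&` _ in pP; have P0 : (0 < P A)%E.
  rewrite lt_neqAle measure_ge0 andbT eq_sym; apply/eqP => PE.
  by rewrite PE /= in pP; lra.
have [w [/= f0 f1] cv] := ae_exists (mopp 0 s) P0 shape.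
have {}cv := cv 0 ltac:(lra).
rewrite -lerN2; apply/ler_addgt0Pr => e e0.
apply: (cvgr_to_le cv).
near=> n.
have n0 : (0 < n)%N by near: n; exists 1%N.
rewrite mul0r (round_to_zero_nat 0) ler_pdivrMr ?ltr0n//.
have bp i := b_sign i w.
have := min_action_two_sites (fun i => b_le1 i w) (fun x => f_lec x w) n.-1 bp f0 f1.
rewrite prednK// => /le_trans; apply.
have cen : c + s <= e * n%:R.
  rewrite -ler_pdivrMl// mulrC ltW// (lt_le_trans (truncnS_gt _))// ler_nat.
  by near: n; exists (Num.truncn ((c + s) / e)).+1.
rewrite -subn1 natrB//; lra.
Unshelve. all: by end_near.
Qed.

(** The straight walk has a centred action [S n], and [- S n / n] is eventually at least
    [Lambda 1 - e], so the limit is compared with a mean equal to zero. *)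
Lemma shape1_le : Lambda 1 <= 0.
Proof.
pose S n w := \sum_(1 <= i < n.+1) b i w * f i w.
have bS n : bounded_rv (S n) by apply: bounded_rv_sum => i; exact: bounded_rvM.
have S_le n w : `|S n w| <= c * n%:R.
  have -> : c * n%:R = \sum_(1 <= i < n.+1) c by rewrite sumr_const_nat subn1 mulr_natr.
  apply: le_trans (ler_norm_sum _ _ _) _; apply: ler_sum => i _.
  by rewrite normrM b_norm mul1r.
have ES n : mean P (S n) = 0.
  by rewrite mean_sum ?big1// => i; [rewrite mean_bf|exact: bounded_rvM].
apply: (@le_of_eventual_mean _ _ _ P (fun n w => - n%:R^-1 * S n w) c).
- by move=> n; apply: measurable_funM => //; exact: (bS n).1.
(* At [n = 0] the inverse is [0] by convention and the variable vanishes. *)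
- move=> [|n] w; first by rewrite invr0 oppr0 mul0r normr0 ltW.
  rewrite normrM normrN normfV normr_nat ler_pdivrMl ?ltr0n// mulrC; exact: S_le.
- apply: filterS shape => w cv e e0.
  have /cvgrPdist_le/(_ e e0)[M _ HM] := cv 1 ltac:(lra).
  exists M.+1 => // n /= Mn.
  have n0 : (0 < n)%N by exact: leq_trans Mn.
  have := HM n (ltnW Mn).
  rewrite mul1r round_to_zero_nat ler_norml => /andP[h1 h2].
  have h3 := min_action_straight (b ^~ w) (f ^~ w) n.
  have := ler_wpM2l (ltac:(by rewrite invr_ge0) : 0 <= n%:R^-1) h3.
  rewrite -/(S n w); lra.
- by near=> n; rewrite meanZ// ES mulr0.
Unshelve. all: by end_near.
Qed.

Lemma shape_le_linear : exists2 K : R, 0 < K &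
  forall a : R, 0 <= a <= 1 -> Lambda a <= c - K * a.
Proof.
(* With probability at least [p] a visited site has [c - |f x| >= c / 2], so it costs at least
   [c / 2 * p] in mean. *)
have [p p0 pP] := small_values; exists (c / 2 * p); first by rewrite mulr_gt0// divr_gt0.
move=> a /andP[a0 a1]; set K := c / 2 * p.
have K0 : 0 < K by rewrite mulr_gt0// divr_gt0.
pose k n := Num.truncn (a * n%:R).
have an0 n : 0 <= a * n%:R by rewrite mulr_ge0.
have kn n : (k n <= n)%N.
  rewrite -(@ler_nat R); apply: (@le_trans _ _ (a * n%:R)); first by rewrite truncn_le.
  by rewrite ler_piMl.
have rk n : round_to_zero (a * n%:R) = k n.
  by rewrite /round_to_zero an0 /k truncn_floor an0 gez0_abs// floor_ge0.
pose D x w := c - `|f x w|.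
have bD x : bounded_rv (D x).
  by apply: bounded_rvB; [exact: bounded_rv_cst|exact: bounded_rv_norm].
have D0 x w : 0 <= D x w by rewrite subr_ge0.
have Dc x w : D x w <= c by rewrite lerBlDr lerDl.
have ED x : K <= mean P (D x).
  apply: (@le_trans _ _ (c / 2 * fine (P [set w | `|f x w| <= c / 2]))).
    by rewrite ler_wpM2l// divr_ge0// ltW.
  apply: mean_ge_prob => //.
    by apply: measurable_rv_le => //; exact: (bounded_rv_norm (f_rv x)).1.
  by move=> w /= fw; rewrite /D; lra.
pose S n w := \sum_(1 <= x < (k n).+1) D x w.
have bS n : bounded_rv (S n) by apply: bounded_rv_sum => x.
have S0 n w : 0 <= S n w by apply: sumr_ge0.
have Sc n w : S n w <= c * n%:R.
  apply: (@le_trans _ _ (\sum_(1 <= x < (k n).+1) c)); first exact: ler_sum.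
  rewrite sumr_const_nat subn1 -[leLHS]mulr_natr.
  by apply: ler_wpM2l; [exact: ltW|rewrite ler_nat; exact: kn].
have ES n : K * (k n)%:R <= mean P (S n).
  rewrite mean_sum//.
  apply: (@le_trans _ _ (\sum_(1 <= x < (k n).+1) K)); last exact: ler_sum.
  by rewrite sumr_const_nat subn1 mulr_natr.
suff : Lambda a - c <= - (K * a) by lra.
apply/ler_addgt0Pr => e e0.
apply: (@le_of_eventual_mean _ _ _ P (fun n w => - n%:R^-1 * S n w) c).
- by move=> n; apply: measurable_funM => //; exact: (bS n).1.
- move=> [|n] w; first by rewrite invr0 oppr0 mul0r normr0 ltW.
  by rewrite normrM normrN normfV normr_nat ger0_norm// ler_pdivrMl ?ltr0n// mulrC.
- apply: filterS shape => w cv e' e'0.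
  have /cvgrPdist_le/(_ e' e'0)[M _ HM] := cv a ltac:(lra).
  exists M.+1 => // n /= Mn.
  have n0 : (0 < n)%N by exact: leq_trans Mn.
  have := HM n (ltnW Mn).
  rewrite rk ler_norml => /andP[h1 h2].
  have h3 : S n w - c * n%:R <= min_action (b ^~ w) (f ^~ w) n (k n).
    apply: le_min_action => // g lg g0 gn.
    exact: (action_ge_visited (fun i => b_le1 i w) (fun x => f_lec x w)).
  have := ler_wpM2l (ltac:(by rewrite invr_ge0) : 0 <= n%:R^-1) h3.
  rewrite mulrBr (mulrC c) mulKf ?pnatr_eq0 -?lt0n//; lra.
- near=> n.
  have n0 : (0 < n)%N by near: n; exists 1%N.
  have n0R : (0 : R) < n%:R by rewrite ltr0n.
  rewrite meanZ// mulNr lerNl opprD opprK ler_pdivlMl//.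
  apply: le_trans (ES n).
  (* Rounding loses at most one site, hence at most [K] in mean; the slack [e n] absorbs this. *)
  have kS : a * n%:R < (k n)%:R + 1 by rewrite natr1; exact: truncnS_gt.
  have Ken : K <= e * n%:R.
    rewrite -ler_pdivrMl// mulrC ltW// (lt_le_trans (truncnS_gt _))// ler_nat.
    by near: n; exists (Num.truncn (K / e)).+1.
  have := ler_wpM2l (ltW K0) (ltW kS); lra.
Unshelve. all: by end_near.
Qed.

(** * Gain from the better of two blocks *)

Let first_rv N t x w := wait_first_block (b ^~ w) (f ^~ w) N t x.
Let last_rv N t x w := wait_last_block (b ^~ w) (f ^~ w) N t x.
Let best_rv N t x w := Num.min (first_rv N t x w) (last_rv N t x w).

Let bounded_first N t x : bounded_rv (first_rv N t x).
Proof. by apply: bounded_rv_sum => r; exact: bounded_rvM. Qed.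

Let bounded_last N t x : bounded_rv (last_rv N t x).
Proof. by apply: bounded_rv_sum => r; exact: bounded_rvM. Qed.

(** The minimum of two numbers is half of their sum minus their distance. *)
Let best_rvE N t x w : best_rv N t x w =
  2^-1 * (first_rv N t x w + last_rv N t x w - `|gap N t x w|).
Proof.
have -> : gap N t x w = last_rv N t x w - first_rv N t x w by rewrite wait_blockB.
rewrite /best_rv; have [h|h] := leP (first_rv N t x w) (last_rv N t x w).
  by rewrite ger0_norm ?subr_ge0//; lra.
by rewrite ler0_norm ?subr_le0 ?ltW//; lra.
Qed.

Let bounded_best N t x : bounded_rv (best_rv N t x).
Proof.
rewrite (_ : best_rv N t x = fun w =>
    2^-1 * (first_rv N t x w + last_rv N t x w - `|gap N t x w|)).
  apply: bounded_rvM; first exact: bounded_rv_cst.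
  by apply: bounded_rvB; [exact: bounded_rvD|exact: bounded_rv_norm].
by apply/funext => w; exact: best_rvE.
Qed.

Let mean_best N t x : mean P (best_rv N t x) = - (2^-1 * mean P (fun w => `|gap N t x w|)).
Proof.
have E1 : mean P (first_rv N t x) = 0.
  by rewrite mean_sum ?big1// => r; [rewrite mean_bf|exact: bounded_rvM].
have E2 : mean P (last_rv N t x) = 0.
  by rewrite mean_sum ?big1// => r; [rewrite mean_bf|exact: bounded_rvM].
rewrite (_ : best_rv N t x = fun w =>
    2^-1 * (first_rv N t x w + last_rv N t x w - `|gap N t x w|)).
  have b1 := bounded_rvD (bounded_first N t x) (bounded_last N t x).
  have b2 := bounded_rv_norm (bounded_gap N t x).
  by rewrite (meanZ P _ (bounded_rvB b1 b2)) (meanB P b1 b2) meanD// E1 E2 addr0 sub0r mulrN.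
by apply/funext => w; exact: best_rvE.
Qed.

Let best_norm N t x w : `|best_rv N t x w| <= c * N.+1%:R.
Proof.
have h (t' x' : nat -> int) :
    `|\sum_(r < N.+1) b (t' r) w * f (x' r) w| <= c * N.+1%:R.
  have -> : c * N.+1%:R = \sum_(r < N.+1) c by rewrite sumr_const card_ord mulr_natr.
  apply: le_trans (ler_norm_sum _ _ _) _; apply: ler_sum => i _.
  by rewrite normrM b_norm mul1r.
rewrite /best_rv; case: (leP (first_rv N t x w)) => _.
  exact: (h (fun r => t + r.+1%:Z) (fun r => x + r%:Z)).
exact: (h (fun r => t + r.+1%:Z) (fun r => x + (minn r.+1 N)%:Z)).
Qed.

Lemma shape_gt_somewhere : exists2 a : R, 0 < a < 1 & c * (1 - a) < Lambda a.
Proof.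
have c2 : 0 <= c / 2 < c by have := c0; lra.
have [p p0 pP] := opposite_neighbours c2.
(* When [f x >= c / 2] and [f (x + 1) <= - c / 2], the squared increment is at least [c ^ 2]. *)
have v0 : 0 < c ^+ 2 * p by rewrite mulr_gt0// exprn_gt0.
have v_le x : c ^+ 2 * p <= mean P (fun w => (f (x + 1) w - f x w) ^+ 2).
  apply: le_trans (ler_wpM2l (sqr_ge0 c) (pP x)) _.
  apply: mean_ge_prob => //.
  - by apply: bounded_rvX; exact: bounded_rvB.
  - by move=> w; exact: sqr_ge0.
  - by move=> w [/= h1 h2]; nra.
(* A mean gap of [4 c] gives a mean gain of [2 c] per block, hence [Lambda a >= 2 c / (N + 1)],
   twice the value [c (1 - a)] of the chord. *)
have [N [N0 gapN]] := mean_gap_unbounded (4 * c) v0 v_le.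
have N0R : (0 : R) < N%:R by rewrite ltr0n.
have N1R : (N.+1%:R : R) = N%:R + 1 by rewrite natr1.
have NS0 : (0 : R) < N.+1%:R by rewrite ltr0n.
exists (N%:R / N.+1%:R).
  by apply/andP; split; [exact: divr_gt0|rewrite ltr_pdivrMr// mul1r ltr_nat].
set a := N%:R / N.+1%:R.
have -> : 1 - a = N.+1%:R^-1 by rewrite /a N1R; field; rewrite -N1R gt_eqF.
suff : - Lambda a <= - (2 * c / N.+1%:R).
  have : 0 < c / N.+1%:R by rewrite divr_gt0.
  rewrite -mulrA; set t := c / _; lra.
pose S m w := \sum_(j < m) best_rv N (N.+1 * j)%N (N * j)%N w.
have bS m : bounded_rv (S m) by apply: bounded_rv_sum.
have Sc m w : `|S m w| <= c * (N.+1 * m)%:R.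
  have -> : c * (N.+1 * m)%:R = \sum_(r < m) c * N.+1%:R.
    by rewrite sumr_const card_ord -[RHS]mulr_natr natrM mulrA.
  by apply: le_trans (ler_norm_sum _ _ _) _; apply: ler_sum => i _.
have ES m : mean P (S m) <= - (2 * c * m%:R).
  rewrite mean_sum// -mulNr mulr_natr -[X in _ *+ X](card_ord m) -sumr_const.
  apply: ler_sum => j _; rewrite mean_best.
  by have := gapN (N.+1 * j)%N (N * j)%N; lra.
apply: (@le_of_eventual_mean _ _ _ P (fun m w => (N.+1 * m)%:R^-1 * S m w) c).
- by move=> m; apply: measurable_funM => //; exact: (bS m).1.
- move=> [|m] w; first by rewrite muln0 invr0 mul0r normr0 ltW.
  by rewrite normrM normfV normr_nat ler_pdivrMl ?ltr0n ?muln_gt0// mulrC.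
- apply: filterS shape => w cv e e0.
  have aI : -1 <= a <= 1.
    rewrite (@le_trans _ _ 0) ?oppr_le0 ?divr_ge0//=.
    by rewrite ler_pdivrMr// mul1r ler_nat.
  have /cvgrPdist_le/(_ e e0)[M _ HM] := cv a aI.
  exists M => // m /= Mm.
  have := HM (N.+1 * m)%N (leq_trans Mm (leq_pmull _ _)) => /(_ erefl).
  (* Along the times [(N + 1) m] the endpoint is exactly [N m], so no rounding occurs. *)
  have -> : a * (N.+1 * m)%:R = (N * m)%:R by rewrite /a !natrM; field; rewrite gt_eqF.
  rewrite round_to_zero_nat ler_norml => /andP[h1 h2].
  have h3 := min_action_blocks (fun i => b_le1 i w) (fun x => f_lec x w) N m.
  apply: (@le_trans _ _ (min_action (b ^~ w) (f ^~ w) (N.+1 * m) (N * m)%N /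
      (N.+1 * m)%:R)); first by rewrite lerBlDr addrC -lerBlDr.
  by rewrite mulrC ler_wpM2l// invr_ge0.
- near=> m.
  have m0 : (0 < m)%N by near: m; exists 1%N.
  have m0R : (0 : R) < m%:R by rewrite ltr0n.
  rewrite meanZ// ler_pdivrMl ?ltr0n ?muln_gt0//.
  apply: le_trans (ES m) _; rewrite natrM le_eqVlt; apply/orP; left; apply/eqP.
  by field; rewrite gt_eqF.
Unshelve. all: by end_near.
Qed.

End Model.

(** * Integrals of the density *)

Section Density.
Set Implicit Arguments.
Unset Strict Implicit.
Unset Printing Implicit Defensive.
Context {R : realType}.
Variables (c : R) (rho : R -> R).
Hypotheses (rho_cont : {within `]- c, c[, continuous rho})
  (rho_pos : forall x : R, - c < x < c -> 0 < rho x)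
  (rho_out : forall x : R, ~ (- c < x < c) -> rho x = 0).

(** A zero integral would make [rho] vanish almost everywhere on an interval of positive length
    where it is positive. *)
Lemma integral_density_gt0 (u v : R) : - c <= u -> u < v -> v <= c ->
  (0 < \int[lebesgue_measure]_(y in `]u, v[) (rho y)%:E)%E.
Proof.
move=> cu uv vc; have sub : `]u, v[ `<=` `]- c, c[.
  by move=> y /=; rewrite !in_itv /= => /andP[? ?]; apply/andP; split; lra.
have uvc y : `]u, v[%classic y -> - c < y < c by move=> /sub /=; rewrite in_itv.
have mrho : measurable_fun `]u, v[ rho.
  apply: (measurable_funS _ sub) => //; exact: subspace_continuous_measurable_fun.
rewrite lt_neqAle integral_ge0 ?andbT; last first.
  by move=> y /uvc yc; rewrite lee_fin ltW// rho_pos.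
apply/eqP => /esym int0.
have mErho : measurable_fun `]u, v[ (EFin \o rho) by exact/measurable_EFinP.
have abs0 : (\int[lebesgue_measure]_(y in `]u, v[) `|(rho y)%:E| = 0)%E.
  rewrite -int0; apply: eq_integral => y /set_mem /uvc yc.
  by rewrite /= ger0_norm// ltW// rho_pos.
have [//|/(_ abs0) [N [mN N0 subN]] _] := ae_eq_integral_abs lebesgue_measure _ mErho.
have : (lebesgue_measure `]u, v[%classic <= lebesgue_measure N)%E.
  apply: le_measure; rewrite ?inE// => y uvy; apply: subN => /= /(_ uvy)[] rho0.
  by have := rho_pos (uvc _ uvy); rewrite rho0 ltxx.
by rewrite N0 lebesgue_measure_itv/= lte_fin uv -EFinB lee_fin subr_le0 leNgt uv.
Qed.

Lemma integral_density_out (A : set R) : (forall y, A y -> ~ (- c < y < c)) ->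
  (\int[lebesgue_measure]_(y in A) (rho y)%:E = 0)%E.
Proof. by move=> Aout; apply: integral0_eq => y /Aout /rho_out ->. Qed.

End Density.

(** * Concavity, and transfer of the model to the given variables *)

Lemma ae_forall_int {R : realType} {d : measure_display} {T : measurableType d}
    (P : probability T R) (Q : int -> T -> Prop) :
  (forall i, {ae P, forall w, Q i w}) -> {ae P, forall w, forall i, Q i w}.
Proof.
move=> aeQ.
have aePos := ae_foralln (fun n => aeQ (Posz n)).
have aeNeg := ae_foralln (fun n => aeQ (Negz n)).
by apply: filterS2 aePos aeNeg => w QP QN [].
Qed.

(** The line [c (1 - a)] is the chord of [Lambda] over [[0, 1]]. A point [a] left of [a0] is a
    mixture of [a0] and [0], a point to the right one of [a0] and [1]; concavity passes the strict
    inequality on with the positive weight of [a0]. *)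
Lemma concave_gt_chord {R : realType} (c a0 : R) (Lambda : R -> R) :
  (forall a b t : R, -1 <= a <= 1 -> -1 <= b <= 1 -> 0 <= t <= 1 ->
     t * Lambda a + (1 - t) * Lambda b <= Lambda (t * a + (1 - t) * b)) ->
  Lambda 0 = c -> Lambda 1 = 0 -> 0 < a0 < 1 -> c * (1 - a0) < Lambda a0 ->
  forall a, 0 < a < 1 -> c * (1 - a) < Lambda a.
Proof.
move=> conc L0 L1 /andP[a00 a01] La0 a /andP[a_0 a_1].
case: (leP a a0) => aa0.
  have t0 : 0 < a / a0 by exact: divr_gt0.
  have t1 : a / a0 <= 1 by rewrite ler_pdivrMr// mul1r.
  have := conc a0 0 (a / a0) ltac:(lra) ltac:(lra) ltac:(lra).
  rewrite L0 mulr0 addr0 divfK ?gt_eqF//; apply: lt_le_trans.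
  have := ltr_pM2l t0 (c * (1 - a0)) (Lambda a0); rewrite La0.
  rewrite mulrCA mulrBr mulr1 divfK ?gt_eqF//; lra.
set t := (1 - a) / (1 - a0).
have a0' : 0 < 1 - a0 by lra.
have t0 : 0 < t by rewrite divr_gt0//; lra.
have t1 : t <= 1 by rewrite ler_pdivrMr// mul1r; lra.
have ta0 : t * (1 - a0) = 1 - a by rewrite divfK// gt_eqF.
have := conc a0 1 t ltac:(lra) ltac:(lra) ltac:(lra).
have -> : t * a0 + (1 - t) * 1 = a by lra.
rewrite L1 mulr0 addr0; apply: lt_le_trans.
by rewrite -ta0 mulrCA ltr_pM2l.
Qed.

Theorem theorem2p2 (R : realType) (d : measure_display) (T : measurableType d)
  (P : probability T R) (c q kappa : R) (rho : R -> R)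
  (F B : int -> {RV P >-> R}) (Lambda : R -> R) :
  0 < c -> 0 < q -> -1 < kappa ->
  (* the density rho *)
  (forall x : R, rho (- x) = rho x) ->
  {within `]- c, c[, continuous rho} ->
  (forall x : R, - c < x < c -> 0 < rho x) ->
  (forall x : R, ~ (- c < x < c) -> rho x = 0) ->
  (rho x / (`|c - x| `^ kappa)) @[x --> c^'-] --> q ->
  (* F and B mutually independent families of independent variables *)
  mutually_independent
    (fun j : int + int => match j with inl x => F x | inr i => B i end) ->
  (* each F(x) has density rho *)
  (forall (x : int) (A : set R), measurable A ->
     P (F x @^-1` A) = (\int[lebesgue_measure]_(y in A) (rho y)%:E)%E) ->
  (* each B(i) is a fair +-1 sign *)
  (forall i : int, P (B i @^-1` [set 1]) = (1 / 2)%:E /\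
                   P (B i @^-1` [set -1]) = (1 / 2)%:E) ->
  (* Lambda is the shape function *)
  {within `[-1, 1], continuous Lambda} ->
  (forall a : R, Lambda (- a) = Lambda a) ->
  (forall a b t : R, -1 <= a <= 1 -> -1 <= b <= 1 -> 0 <= t <= 1 ->
     t * Lambda a + (1 - t) * Lambda b <= Lambda (t * a + (1 - t) * b)) ->
  (forall a : R, -1 <= a <= 1 -> 0 <= Lambda a) ->
  {ae P, forall w, forall a : R, -1 <= a <= 1 ->
     (fun n : nat => min_action (fun i => B i w) (fun x => F x w) n
                       (round_to_zero (a * n%:R)) / n%:R) @ \oo --> - Lambda a} ->
  (* conclusion *)
  [/\ Lambda 0 = c, Lambda 1 = 0, Lambda (-1) = 0,
      (forall a : R, 0 < `|a| < 1 -> c * (1 - `|a|) < Lambda a) &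
      exists2 K : R, 0 < K & forall a : R, -1 <= a <= 1 -> Lambda a <= c - K * `|a|].
Proof.
move=> c0 _ _ _ rho_cont rho_pos rho_out _ indep lawF lawB _ Leven Lconc Lnneg Lshape.
pose X (j : int + int) := match j with inl x => F x | inr i => B i end.
(* Each [F x] lies in []- c, c[] only almost surely; clipping makes the bound hold at every outcome
   and changes [F x] on a null set only. *)
pose clip (y : R) := Num.max (- c) (Num.min c y).
have mclip : measurable_fun setT clip.
  by apply: measurable_maxr => //; exact: measurable_minr.
have clip_norm y : `|clip y| <= c.
  rewrite ler_norml /clip le_max lexx /= ge_max ge_min lexx /= andbT.
  by rewrite (le_trans _ (ltW c0))// oppr_le0 ltW.
have clip_id y : - c < y < c -> clip y = y.
  by move=> /andP[y1 y2]; rewrite /clip min_r ?max_r ?ltW.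
(* Clipping preserves the events at these thresholds, so their probabilities follow from the law of
   [F]. *)
have clip_ge s y : - c < s <= c -> (s <= clip y) = (s <= y).
  move=> /andP[cs sc]; rewrite /clip le_max le_min sc /=.
  by rewrite (_ : (s <= - c) = false) //; apply/negbTE; rewrite -ltNge.
have clip_le s y : - c <= s < c -> (clip y <= s) = (y <= s).
  move=> /andP[cs sc]; rewrite /clip ge_max ge_min cs /=.
  by rewrite (_ : (c <= s) = false) //; apply/negbTE; rewrite -ltNge.
pose f x w := clip (F x w).
have mset1 : measurable [set (1 : R)] by exact: measurable_set1.
(* Agrees with [B i] wherever [B i] is plus or minus one, that is, almost surely. *)
pose b i := sign_rv X (inr i) [set 1].
pose G i := cylinders_off X (inr i).
have mX i j : j != inr i ->
    measurable_fun setT (X j : g_sigma_algebraType (G i) -> R).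
  move=> ji _ A mA; rewrite setTI.
  by apply: sub_sigma_algebra; exact: preimage_cylinders_off.
have f_rv x : bounded_rv (f x).
  by split; [exact: measurableT_comp|exists c => w; exact: clip_norm].
have b_rv i : bounded_rv (b i) by exact: bounded_sign_rv.
have f_off i x : off G i (f x).
  by split=> //; apply: measurableT_comp => //; exact: (mX i (inl x)).
have b_off i j : j != i -> off G i (b j).
  move=> ji; split=> //; have -> : b j = fun w => 2 * \1_[set 1] (X (inr j) w) - 1.
    apply/funext => w; rewrite /b /sign_rv indicE.
    by case: (_ \in _); rewrite ?mulr1 ?mulr0 ?sub0r//; lra.
  apply: measurable_funB => //; apply: measurable_funM => //.
  by apply: measurableT_comp => //; exact: (mX i (inr j)).
have mean_bM i Y : off G i Y -> mean P (fun w => b i w * Y w) = 0.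
  move=> [bY mY]; apply: mean_sign_mul => //; exact: (lawB i).1.
have mF x (A : set R) : measurable A -> measurable (F x @^-1` A).
  by move=> mA; rewrite -[X in measurable X]setTI; exact: measurable_funP.
have mB i (A : set R) : measurable A -> measurable (B i @^-1` A).
  by move=> mA; rewrite -[X in measurable X]setTI; exact: measurable_funP.
have aeF : {ae P, forall w, forall x, f x w = F x w}.
  apply: ae_forall_int => x; exists (F x @^-1` (~` `]- c, c[)); split.
  - by apply: mF; exact: measurableC.
  - rewrite lawF; last exact: measurableC.
    by apply: (integral_density_out rho_out) => y /=; rewrite in_itv.
  - move=> w /= fF; apply: contra_not fF => /=.
    by move=> Fc; apply: clip_id; move: Fc; rewrite in_itv.
have aeB : {ae P, forall w, forall i, b i w = B i w}.
  apply: ae_forall_int => i; exists (B i @^-1` (~` ([set 1] `|` [set -1]))); split.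
  - by apply: mB; apply: measurableC; exact: measurableU.
  - rewrite -preimage_setC probability_setC; last by apply: mB; exact: measurableU.
    rewrite preimage_setU measureU; [|exact: mB|exact: mB|].
      rewrite [X in (_ - X)%E](_ : _ = 1%E) ?subee//.
      transitivity ((1 / 2)%:E + (1 / 2)%:E : \bar R)%E.
        by congr (_ + _)%E; [exact: (lawB i).1|exact: (lawB i).2].
      by rewrite -EFinD; congr EFin; lra.
    by apply/seteqP; split=> w //= [-> ]; lra.
  - move=> w /= bB; apply: contra_not bB => -[B1|B1]; rewrite /b /sign_rv /= B1.
      by rewrite mem_set.
    by rewrite memNset//=; lra.
have shape : {ae P, forall w, forall a : R, -1 <= a <= 1 ->
    (fun n : nat => min_action (b ^~ w) (f ^~ w) n (round_to_zero (a * n%:R)) / n%:R)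
      @ \oo --> - Lambda a}.
  apply: filterS3 aeF aeB Lshape => w fF bB cv a aI.
  have -> : b ^~ w = B ^~ w by apply/funext => i; exact: bB.
  have -> : f ^~ w = F ^~ w by apply/funext => x; exact: fF.
  exact: cv.
have lawF0 x (A : set R) : measurable A -> P (F x @^-1` A) = P (F 0 @^-1` A).
  by move=> mA; rewrite !lawF.
have law_gt0 (u v : R) (A : set R) : measurable A -> - c <= u -> u < v -> v <= c ->
    `]u, v[ `<=` A -> 0 < fine (P (F 0 @^-1` A)).
  move=> mA cu uv vc uvA.
  rewrite fine_gt0// (le_lt_trans (probability_le1 P (mF 0 A mA)) (ltry 1)) andbT.
  apply: (@lt_le_trans _ _ (P (F 0 @^-1` `]u, v[))).
    by rewrite lawF//; exact: (integral_density_gt0 rho_cont).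
  by apply: le_measure; rewrite ?inE; [exact: mF|exact: mF|exact: preimage_subset].
have opposite s : 0 <= s < c -> exists2 p : R, 0 < p & forall x,
    p <= fine (P ([set w | s <= f x w] `&` [set w | f (x + 1) w <= - s])).
  move=> /andP[s0 sc].
  have mU : measurable (`[s, +oo[ : set R) by [].
  have mD : measurable (`]-oo, - s] : set R) by [].
  (* By independence of [F x] and [F (x + 1)] the probability is this product; both factors are
     taken at the site [0], since all sites have the same law. *)
  exists (fine (P (F 0 @^-1` `[s, +oo[)) * fine (P (F 0 @^-1` `]-oo, - s]))).
    apply: mulr_gt0.
      apply: (law_gt0 s c) => //; first by lra.
      by move=> y /=; rewrite !in_itv/= => /andP[/ltW ->].
    apply: (law_gt0 (- c) (- s)) => //; try lra.
    by move=> y /=; rewrite !in_itv/= => /andP[_ /ltW ->].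
  move=> x.
  pose A (j : int + int) : set R := if j == inl x then `[s, +oo[%classic else `]-oo, - s]%classic.
  have fge y : (s <= clip y) = (s <= y) by rewrite clip_ge//; lra.
  have fle y : (clip y <= - s) = (y <= - s) by rewrite clip_le//; lra.
  have x1 : (inl (x + 1) == inl x :> (int + int)%type) = false.
    by apply/negbTE/eqP => -[]; lia.
  have Ax : A (inl x) = `[s, +oo[%classic by rewrite /A eqxx.
  have Ax1 : A (inl (x + 1)) = `]-oo, - s]%classic by rewrite /A x1.
  have -> : [set w | s <= f x w] `&` [set w | f (x + 1) w <= - s] =
      \bigcap_(j in [set` [:: inl x; inl (x + 1)] : seq (int + int)]) X j @^-1` A j.
    apply/seteqP; split=> w /=.
      rewrite fge fle => -[h1 h2] j /=; rewrite !inE => /orP[]/eqP ->.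
        by rewrite /preimage /= Ax /= in_itv/= h1.
      by rewrite /preimage /= Ax1 /= in_itv/= h2.
    move=> h; rewrite fge fle; split.
      by have := h (inl x) (mem_head _ _); rewrite /preimage /= Ax /= in_itv/= andbT.
    have x1in : inl (x + 1) \in ([:: inl x; inl (x + 1)] : seq (int + int)).
      by rewrite !inE eqxx orbT.
    by have := h (inl (x + 1)) x1in; rewrite /preimage /= Ax1 /= in_itv.
  rewrite indep//=; last first.
  - by move=> j; rewrite /A; case: ifP.
  - by rewrite inE eq_sym x1.
  rewrite !big_cons big_nil mule1 Ax Ax1 /= fineM.
  - by rewrite !lawF0.
  - by apply: fin_num_measure; exact: mF.
  - by apply: fin_num_measure; exact: mF.
have small : exists2 p : R, 0 < p & forall x, p <= fine (P [set w | `|f x w| <= c / 2]).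
  exists (fine (P (F 0 @^-1` `[- (c / 2), c / 2]))).
    apply: (law_gt0 (- (c / 2)) (c / 2)) => //; try lra.
    by apply: subset_itvW; rewrite lexx.
  move=> x; rewrite -(lawF0 x)//.
  suff -> : [set w | `|f x w| <= c / 2] = F x @^-1` `[- (c / 2), c / 2] by [].
  apply/funext => w; apply/propext.
  by rewrite /= in_itv/= ler_norml /f clip_ge ?clip_le//; lra.
have b_sign i w : b i w = 1 \/ b i w = -1 by exact: sign_rvE.
have f_lec x w : `|f x w| <= c by exact: clip_norm.
have [K K0 LK] := shape_le_linear c0 b_sign f_rv f_lec shape small.
have L0 : Lambda 0 = c.
  apply/eqP; rewrite eq_le; apply/andP; split.
    by have := LK 0; rewrite mulr0 subr0 lexx ler01; exact.
  exact: (shape0_ge c0 b_sign f_rv f_lec shape opposite).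
have L1 : Lambda 1 = 0.
  apply/eqP; rewrite eq_le Lnneg ?lexx ?andbT; last lra.
  exact: (shape1_le c0 b_sign b_rv f_rv f_lec f_off mean_bM shape).
split=> //; first by rewrite Leven.
- have [a0 a0I La0] := shape_gt_somewhere c0 b_sign b_rv f_rv f_lec f_off b_off mean_bM
    shape opposite.
  move=> a aI.
  (* Evenness reduces both bounds to nonnegative slopes. *)
  have -> : Lambda a = Lambda `|a|.
    by case: (ger0P a) => // _; rewrite Leven.
  exact: (concave_gt_chord Lconc L0 L1 a0I La0).
- exists K => // a aI.
  have -> : Lambda a = Lambda `|a|.
    by case: (ger0P a) => // _; rewrite Leven.
  by apply: LK; rewrite normr_ge0 /= ler_norml.
Qed.
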